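(* Let $k\ge1$ be an integer. There is a constant $C>0$, depending only on $k$ (and in particular independent of $q$), such that the following holds for every finite field $\mathbb F_q$. Let $P(x)\in\mathbb F_q[x_1,x_2,x_3]$ be a homogeneous polynomial of degree $k$, and suppose that the homogeneous variety $H=\{x\in\mathbb F_q^3:P(x)=0\}$ does not contain any plane passing through the origin in $\mathbb F_q^3$. Then for any $m\in\mathbb F_q^3$ with $m\ne(0,0,0)$, $$|\widehat H(m)|=\left|\frac1{q^3}\sum_{x\in H}\chi(-m\cdot x)\right|\le C\,q^{-2}.$$
   Context: $\mathbb F_q$ is the finite field with $q$ elements, $\chi$ is a fixed nontrivial additive character of $\mathbb F_q$, and $m\cdot x=m_1x_1+m_2x_2+m_3x_3$. A polynomial is homogeneous of degree $k$ if all its monomials with nonzero coefficients have total degree $k$. A plane passing through the origin is a set $\{x\in\mathbb F_q^3:m\cdot x=0\}$ with $m\ne(0,0,0)$. The set $H$ is identified with its characteristic function, whose Fourier transform is $\widehat H(m)=q^{-3}\sum_{x\in H}\chi(-m\cdot x)$. *)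

(* Defs.v *)
From mathcomp Require Import all_boot all_order all_algebra.
From mathcomp Require Import reals.
From mathcomp.real_closed Require Import complex.
From mathcomp.multinomials Require Import mpoly.

Set Implicit Arguments.
Unset Strict Implicit.
Unset Printing Implicit Defensive.

Import Order.TTheory GRing.Theory Num.Theory.
Local Open Scope ring_scope.

Definition additive_character (R : realType) (F : finFieldType)
    (chi : F -> R[i]) : Prop :=
  chi 0 = 1 /\ forall a b : F, chi (a + b) = chi a * chi b.

Definition nontrivial_character (R : realType) (F : finFieldType)
    (chi : F -> R[i]) : Prop :=
  exists a : F, chi a != 1.

Definition dot (F : finFieldType) (m x : 'rV[F]_3) : F :=
  \sum_(i < 3) m ord0 i * x ord0 i.

Definition plane0 (F : finFieldType) (m : 'rV[F]_3) : {set 'rV[F]_3} :=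
  [set x | dot m x == 0].

Definition variety (F : finFieldType) (P : {mpoly F[3]}) : {set 'rV[F]_3} :=
  [set x : 'rV[F]_3 | P.@[fun i => x ord0 i] == 0].

(* Normalized Fourier transform of the indicator function of H. *)
Definition fourier (R : realType) (F : finFieldType) (chi : F -> R[i])
    (H : {set 'rV[F]_3}) (m : 'rV[F]_3) : R[i] :=
  (#|F|%:R ^+ 3)^-1 * \sum_(x in H) chi (- dot m x).

(* Main.v *)
Require Import Defs.
From mathcomp Require Import all_boot all_order all_algebra.
From mathcomp Require Import reals zify.
From mathcomp.real_closed Require Import complex.
From mathcomp.multinomials Require Import mpoly.

Set Implicit Arguments.
Unset Strict Implicit.
Unset Printing Implicit Defensive.

Import Order.TTheory GRing.Theory Num.Theory.
Local Open Scope ring_scope.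
Local Open Scope complex_scope.

(** Write H for the zero set of P, q for the cardinality of F and S for the sum
of chi (- m . x) over H.  Since P is homogeneous, H is stable under scaling,
so averaging S over the scalings by nonzero t and using the orthogonality
relation for chi gives
    (q - 1) S = q |H :&: m^perp| - |H|
([mul_card_sum_cone]).  It remains to see that both terms on the right are at
most k q^2, since then |S| <= 2 k q.

Both bounds come from one line-counting argument ([card_zeros_stable]).  If
P w != 0, then t |-> P (y + t w) is for every y a polynomial of degree k with
leading coefficient P w, so every line of direction w meets H in at most k
points.  Summing over the points of a set W stable under translation by the
line spanned by w gives q |W :&: H| <= k |W|.  As H contains no plane through
the origin, such a w exists in m^perp; that w serves for W = m^perp, which has
at most q^2 points, and for W the whole space. *)

(** * Homogeneous polynomials along a line *)

Lemma coefM_top (R : nzRingType) (p q : {poly R}) (a b : nat) :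
  (size p <= a.+1)%N -> (size q <= b.+1)%N -> (p * q)`_(a + b) = p`_a * q`_b.
Proof.
move=> szp szq; rewrite coefM.
have lt_a : (a < (a + b).+1)%N by rewrite ltnS leq_addr.
rewrite (bigD1 (Ordinal lt_a)) //= addKn big1 ?addr0 // => j neq_ja.
have [le_ja|lt_aj] := leqP j a; last first.
  by rewrite (nth_default _ (leq_trans szp _)) ?mul0r.
have {le_ja} lt_ja : (j < a)%N by rewrite ltn_neqAle le_ja andbT.
by rewrite [q`__]nth_default ?mulr0 // (leq_trans szq) // ltn_subRL ltn_add2r.
Qed.

(** A product of d affine polynomials y_i + w_i X has size at most d + 1; its
coefficient of degree d, which may vanish, is the product of the w_i. *)
Lemma size_coef_prod_line (R : idomainType) (n : nat) (m : 'I_n -> nat)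
    (y w : 'I_n -> R) (r : seq 'I_n) :
  let p := \prod_(i <- r) ((y i)%:P + w i *: 'X) ^+ m i in
  let d := (\sum_(i <- r) m i)%N in
  (size p <= d.+1)%N /\ p`_d = \prod_(i <- r) w i ^+ m i.
Proof.
have size_line i : (size ((y i)%:P + w i *: 'X)%R <= 2)%N.
  rewrite (leq_trans (size_polyD _ _)) // geq_max.
  by rewrite (leq_trans (size_polyC_leq1 _)) //
    (leq_trans (size_scale_leq _ _)) ?size_polyX.
have size_mul (p q : {poly R}) a b : (size p <= a.+1)%N -> (size q <= b.+1)%N ->
    (size (p * q)%R <= (a + b).+1)%N.
  by move=> szp szq; rewrite (leq_trans (size_polyMleq _ _)) //; lia.
have line_pow i e : (size (((y i)%:P + w i *: 'X) ^+ e)%R <= e.+1)%N /\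
    (((y i)%:P + w i *: 'X) ^+ e)`_e = w i ^+ e.
  elim: e => [|e [IHs IHc]]; first by rewrite !expr0 size_poly1 coefC.
  rewrite exprS -[e.+1]add1n; split; first exact: size_mul.
  by rewrite coefM_top // IHc coefD coefC coefZ coefX add0r mulr1 exprS.
elim: r => [|i r [IHs IHc]] /=; first by rewrite !big_nil size_poly1 coefC.
have [szi coi] := line_pow i (m i).
rewrite !big_cons; split; first exact: size_mul.
by rewrite coefM_top // coi IHc.
Qed.

(** A line whose direction is not a zero of P meets the zero set of P in at most
k points: the restriction of P to it has P w as coefficient of degree k. *)
Lemma card_zeros_line (F : finFieldType) (n k : nat) (P : {mpoly F[n]})
    (y w : 'I_n -> F) :
  P \is k.-homog -> P.@[w] != 0 ->
  (#|[set t | P.@[fun i => y i + t * w i] == 0]%R| <= k)%N.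
Proof.
move=> homP Pw.
pose mon (m : 'X_{1..n}) := \prod_(i < n) ((y i)%:P + w i *: 'X) ^+ m i.
pose L : {poly F} := \sum_(m <- msupp P) P@_m *: mon m.
have degP m : m \in msupp P -> (\sum_(i < n) m i)%N = k.
  by move=> /(dhomog_mf homP) /=; rewrite mdegE.
have sizeL : (size L <= k.+1)%N.
  rewrite /L big_seq; elim/big_rec: _ => [|m p /degP degm IH].
    by rewrite size_poly0.
  rewrite (leq_trans (size_polyD _ _)) // geq_max IH andbT.
  rewrite (leq_trans (size_scale_leq _ _)) // -degm.
  by have [] := size_coef_prod_line m y w (index_enum 'I_n).
have coefL : L`_k = P.@[w].
  rewrite mevalE coef_sum big_seq [RHS]big_seq; apply: eq_bigr => m /degP degm.
  rewrite coefZ -degm.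
  by have [_ ->] := size_coef_prod_line m y w (index_enum 'I_n).
have hornerL t : L.[t] = P.@[fun i => y i + t * w i].
  rewrite mevalE horner_sum; apply: eq_bigr => m _.
  rewrite hornerZ horner_prod; congr (_ * _); apply: eq_bigr => i _.
  by rewrite !hornerE mulrC.
have L0 : L != 0 by apply: contraNneq Pw => L0; rewrite -coefL L0 coef0.
rewrite cardE -ltnS (leq_trans _ sizeL) //; apply: max_poly_roots => //.
  by apply/allP => t; rewrite mem_enum inE /root hornerL.
exact: enum_uniq.
Qed.

(** * Counting along parallel lines *)

(** If every line of direction w meets V in at most k points, then V has density
at most k / |F| in any set W that is a union of such lines. *)
Lemma card_stable_lines (F : finFieldType) (n k : nat) (W V : {set 'rV[F]_n})
    (w : 'rV[F]_n) :
  (forall x t, (x + t *: w \in W) = (x \in W)) ->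
  (forall x, (#|[set t | x + t *: w \in V]%R| <= k)%N) ->
  (#|F| * #|W :&: V| <= k * #|W|)%N.
Proof.
move=> stabW leV.
(* Both sides are compared with the number of pairs (x, t) such that x is in W
   and x + t w is in V. *)
have -> : (#|F| * #|W :&: V| =
    \sum_(t : F) \sum_(x in W) ((x + t *: w)%R \in V))%N.
  rewrite -sum_nat_const; apply: eq_bigr => t _.
  rewrite -sum1_card big_mkcond /= [RHS]big_mkcond
    (reindex_inj (addIr (t *: w))) /=.
  apply: eq_bigr => x _; rewrite inE stabW.
  by case: (x \in W); case: (_ \in V).
rewrite exchange_big mulnC -sum_nat_const /=; apply: leq_sum => x _.
by rewrite -big_mkcond sum1dep_card leV.
Qed.

Lemma dotDZ (F : finFieldType) (m x w : 'rV[F]_3) (t : F) :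
  dot m (x + t *: w) = dot m x + t * dot m w.
Proof.
rewrite /dot mulr_sumr -big_split; apply: eq_bigr => i _ /=.
by rewrite !mxE mulrDr mulrCA.
Qed.

Lemma card_zeros_stable (F : finFieldType) (k : nat) (P : {mpoly F[3]})
    (W : {set 'rV[F]_3}) (w : 'rV[F]_3) :
  P \is k.-homog -> w \notin variety P ->
  (forall x t, (x + t *: w \in W) = (x \in W)) ->
  (#|F| * #|W :&: variety P| <= k * #|W|)%N.
Proof.
move=> homP; rewrite inE => Pw stabW; apply: (card_stable_lines stabW) => x.
apply: leq_trans (card_zeros_line (fun i => x ord0 i) homP Pw).
apply: subset_leq_card; apply/subsetP => t; rewrite !inE.
rewrite (@meval_eq _ _ _ (fun i => x ord0 i + t * w ord0 i)) // => i.
by rewrite !mxE.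
Qed.

(** The lines of a direction transverse to the plane meet it in at most one
point, so [card_stable_lines] applies with k = 1. *)
Lemma card_plane0 (F : finFieldType) (m : 'rV[F]_3) :
  m != 0 -> (#|plane0 m| <= #|F| ^ 2)%N.
Proof.
move=> m0; have [i mi] : exists i, m ord0 i != 0.
  apply/existsP; apply: contraNT m0 => /existsPn mi; apply/eqP/rowP => i.
  by rewrite mxE; apply/eqP/negPn/mi.
have dote : dot m (delta_mx ord0 i) = m ord0 i.
  rewrite /dot (bigD1 i) //= mxE !eqxx mulr1 big1 ?addr0 // => j /negPf ji.
  by rewrite mxE ji andbF mulr0.
have F0 : (0 < #|F|)%N by apply/card_gt0P; exists 0.
rewrite -(leq_pmul2l F0) -expnS -[(#|F| ^ 3)%N]mul1n.
have <- : (#|[set: 'rV[F]_3]| = #|F| ^ 3)%N by rewrite cardsT card_mx.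
rewrite -[plane0 m]setTI.
apply: (@card_stable_lines _ _ _ _ _ (delta_mx ord0 i)).
  by move=> x t; rewrite !inE.
move=> x; apply/card_le1_eqP => s t; rewrite !inE !dotDZ dote => /eqP <-.
by rewrite (inj_eq (addrI _)) => /eqP /(mulIf mi).
Qed.

(** * The character sum over a cone *)

Lemma sum_character (R : realType) (F : finFieldType) (chi : F -> R[i])
    (a : F) :
  additive_character chi -> nontrivial_character chi ->
  \sum_t chi (t * a) = (if a == 0 then #|F| else 0)%:R.
Proof.
move=> [chi0 chiD] [b chib]; case: eqP => [->|/eqP a0].
  by under eq_bigr do rewrite mulr0 chi0; rewrite sumr_const.
have -> : \sum_t chi (t * a) = \sum_t chi t.
  by rewrite [RHS](reindex_inj (mulIf a0)).
have chib1 : chi b - 1 != 0 by rewrite subr_eq0.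
apply: (mulfI chib1); rewrite mulr0 mulrBl mul1r mulr_sumr.
rewrite [X in _ - X](reindex_inj (addrI b)) /=; under eq_bigr do rewrite -chiD.
by rewrite subrr.
Qed.

Lemma mem_varietyZ (F : finFieldType) (k : nat) (P : {mpoly F[3]}) (t : F)
    (x : 'rV[F]_3) :
  P \is k.-homog -> t != 0 -> (t *: x \in variety P) = (x \in variety P).
Proof.
move=> homP t0; rewrite !inE.
suff -> : P.@[fun i => (t *: x) ord0 i] = t ^+ k * P.@[fun i => x ord0 i].
  by rewrite mulf_eq0 expf_eq0 (negPf t0) andbF.
rewrite !mevalE mulr_sumr big_seq [RHS]big_seq; apply: eq_bigr => d d_in.
rewrite mulrCA; congr (_ * _).
have /= <- := dhomog_mf homP d_in; rewrite mdegE -prodrXr -big_split.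
by apply: eq_bigr => i _; rewrite /= mxE exprMn.
Qed.

(** Summing chi (- t (m . x)) over t in F and x in H, the term t = 0 contributes
|H| and each of the q - 1 others the sum over H, by invariance of H; summing
over t first leaves q for each x in H orthogonal to m. *)
Lemma mul_card_sum_cone (R : realType) (F : finFieldType) (chi : F -> R[i])
    (H : {set 'rV[F]_3}) (m : 'rV[F]_3) :
  additive_character chi -> nontrivial_character chi ->
  (forall t x, t != 0 -> (t *: x \in H) = (x \in H)) ->
  (#|F|.-1)%:R * \sum_(x in H) chi (- dot m x) =
    (#|F| * #|plane0 m :&: H|)%:R - #|H|%:R.
Proof.
move=> chiA chiN stabH; have chi0 := chiA.1.
have -> : (#|F| * #|plane0 m :&: H|)%:R =
    \sum_(t : F) \sum_(x in H) chi (t * - dot m x).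
  rewrite exchange_big /=; under eq_bigr do rewrite sum_character // oppr_eq0.
  rewrite -natr_sum -big_mkcondr /= sum_nat_const mulnC; congr ((_ * _)%:R).
  by apply: eq_card => x; rewrite !inE andbC.
rewrite (bigD1 (0 : F)) //=.
under [X in _ = X + _ - _]eq_bigr do rewrite mul0r chi0.
rewrite [X in _ = X + _ - _]sumr_const addrAC subrr add0r.
rewrite [RHS](eq_bigr (fun=> \sum_(x in H) chi (- dot m x))) => [|t t0].
  by rewrite [RHS]sumr_const mulr_natl; congr (_ *+ _);
     rewrite (cardC1 (0 : F)).
rewrite [RHS](reindex_inj (scalerI t0)) /=.
apply: eq_big => [x|x _]; first by rewrite stabH.
rewrite -[t *: x]add0r dotDZ mulrN {2}/dot big1 ?add0r // => i _.
by rewrite mxE mulr0.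
Qed.

(** * The Fourier decay bound *)

Theorem corollary2p5 (R : realType) (k : nat) (hk : (1 <= k)%N) :
  exists2 C : R, 0 < C &
    forall (F : finFieldType) (chi : F -> R[i]) (P : {mpoly F[3]}),
      additive_character chi -> nontrivial_character chi ->
      P \is k.-homog ->
      (forall n : 'rV[F]_3, n != 0 -> ~~ (plane0 n \subset variety P)) ->
      forall m : 'rV[F]_3, m != 0 ->
        `|fourier chi (variety P) m| <= (C * (#|F|%:R ^+ 2)^-1)%:C.
Proof.
(* The factor 2 absorbs the quotient q / (q - 1). *)
exists (2 * k)%:R => [|F chi P chiA chiN homP noplane m m0].
  by rewrite ltr0n muln_gt0.
have /subsetPn [w wm wP] := noplane m m0.
have q1 : (1 < #|F|)%N.
  by rewrite (cardD1 0) (cardD1 1) !inE oner_eq0.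
have q0 : (0 < #|F|)%N by apply: ltnW.
have leA : (#|F| * #|plane0 m :&: variety P| <= k * #|F| ^ 2)%N.
  apply: (leq_trans (card_zeros_stable homP wP _)).
    by move=> x t; move: wm; rewrite !inE dotDZ => /eqP ->; rewrite mulr0 addr0.
  by rewrite leq_mul2l card_plane0 ?orbT.
have leB : (#|variety P| <= k * #|F| ^ 2)%N.
  rewrite -(leq_pmul2l q0) -[variety P]setTI mulnCA -expnS.
  have <- : (#|[set: 'rV[F]_3]| = #|F| ^ 3)%N by rewrite cardsT card_mx.
  by apply: (card_zeros_stable homP wP) => x t; rewrite !inE.
rewrite /fourier.
(* Only the two cardinal bounds and the cone identity matter from here on. *)
have := mul_card_sum_cone m chiA chiN (fun t x => mem_varietyZ x homP).
move: leA leB q1 q0; set A := (#|F| * _)%N; set B := #|variety P|.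
set S := \sum_(x in _) _; move: A B S #|F| => A B S q leA leB q1 q0 eqS.
have le_dist : `|A%:R - B%:R : R[i]| <= (k * q ^ 2)%:R.
  (* Two naturals at most N differ by at most N. *)
  wlog leAB : A B leA leB {eqS} / (A <= B)%N => [hw|].
    by have [/hw|/ltnW/hw] := leqP A B; last rewrite distrC; apply.
  by rewrite distrC -natrB // normr_nat ler_nat (leq_trans (leq_subr _ _)).
have pred0 : (0 < q.-1)%N by rewrite -ltnS prednK.
have leS : `|S| <= (2 * k * q)%:R.
  have c0 : 0 < q.-1%:R :> R[i] by rewrite ltr0n.
  rewrite -(ler_pM2l c0) -{1}(normr_nat _ q.-1) -normrM eqS.
  rewrite (le_trans le_dist) //.
  have le_q : (q <= 2 * q.-1)%N by lia.
  rewrite -natrM ler_nat (_ : q.-1 * _ = k * (2 * q.-1 * q))%N; last by lia.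
  by rewrite leq_mul2l -mulnn leq_mul2r le_q !orbT.
have qC0 : 0 < q%:R :> R[i] by rewrite ltr0n.
rewrite rmorphM /= rmorphV /= ?unitfE ?expf_neq0 ?pnatr_eq0 -?lt0n //.
rewrite rmorphXn /= !rmorph_nat normrM normfV normrX normr_nat.
rewrite (le_trans (ler_wpM2l _ leS)) ?invr_ge0 ?exprn_ge0 ?(ltW qC0) //.
by rewrite natrM exprSr invfM mulrACA mulVf ?gt_eqF // mulr1 mulrC.
Qed.
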